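(* Let $D \ge 1$ and let $w_1, \dots, w_D$ be an orthonormal basis of $\mathbb{R}^D$ (i.e. $w_i^T w_j = 0$ for $i \neq j$ and $w_i^T w_i = 1$). For $1 \le d \le D$ let $W_d := [w_1, w_2, \dots, w_d] \in \mathbb{R}^{D \times d}$. Let $X, X_1, X_2$ be three independent and identically distributed random vectors in $\mathbb{R}^D$ with finite second moments, and put $\sigma^2(i,j) := \sum_{k=i}^{j} \mathrm{Var}(w_k^T X)$ for $1 \le i \le j \le D$. Then for every $d \in \{1, \dots, D\}$ with $\sigma^2(1,d) > 0$, $$\mathbb{E}\big[\|X_1 - X_2\|_2^2\big] = \frac{\sigma^2(1,D)}{\sigma^2(1,d)}\, \mathbb{E}\big[\|W_d^T X_1 - W_d^T X_2\|_2^2\big].$$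
   Context: All vectors are column vectors; $\|\cdot\|_2$ is the Euclidean norm and $\mathrm{Var}$ is the variance of a real random variable. *)

(* Defs.v *)
From HB Require Import structures.
From mathcomp Require Import all_boot all_order all_algebra.
From mathcomp Require Import all_classical all_reals all_analysis.

Set Implicit Arguments.
Unset Strict Implicit.
Unset Printing Implicit Defensive.

Import Order.TTheory GRing.Theory Num.Theory.
Import numFieldNormedType.Exports.

Local Open Scope classical_set_scope.
Local Open Scope ring_scope.

(* Matrices, hence column vectors, over R carry the Borel sigma-algebra of
   their usual topology. *)
HB.instance Definition _ (R : realType) (m n : nat) :=
  @isMeasurable.Build (sigma_display (@open 'M[R]_(m, n))) 'M[R]_(m, n)
    <<s (@open 'M[R]_(m, n)) >> (@sigma_algebra0 _ setT _) (@sigma_algebraC _ _)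
    (@sigma_algebra_bigcup _ setT _).

Section Vectors.
Variables (R : realType) (D : nat).
Implicit Types u v : 'cV[R]_D.

Definition dotcv u v : R := (u^T *m v) ord0 ord0.

(* The library's norm `|v| on matrices is the sup norm. *)
Definition norm2 v : R := Num.sqrt (\sum_(i < D) v i ord0 ^+ 2).

(* A family of D vectors with this property is automatically a basis of
   R^D. *)
Definition orthonormal_basis (w : 'I_D -> 'cV[R]_D) : Prop :=
  (forall i j, i != j -> dotcv (w i) (w j) = 0) /\
  (forall i, dotcv (w i) (w i) = 1).

Definition first_columns (w : 'I_D -> 'cV[R]_D) (d : nat) (hd : (d <= D)%N) :
    'M[R]_(D, d) :=
  \matrix_(i < D, k < d) w (widen_ord hd k) i ord0.

End Vectors.

Section Probability.
Context {dT : measure_display} {T : measurableType dT} {R : realType}.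
Variable P : probability T R.

Definition mutually_independent (I : finType) (dE : measure_display)
    (E : measurableType dE) (X : I -> {RV P >-> E}) : Prop :=
  forall (J : {set I}) (A : I -> set E), (forall i, measurable (A i)) ->
    P (\bigcap_(i in [set` J]) (X i @^-1` A i)) =
    (\prod_(i in J) P (X i @^-1` A i))%E.

(* Laws are compared on measurable sets only: as a function, [distribution]
   also takes (meaningless) values on the other sets. *)
Definition identically_distributed (I : Type) (dE : measure_display)
    (E : measurableType dE) (X : I -> {RV P >-> E}) : Prop :=
  forall (i j : I) (A : set E), measurable A ->
    distribution P (X i) A = distribution P (X j) A.

Definition finite_second_moments (D : nat) (X : {RV P >-> 'cV[R]_D}) : Prop :=
  forall i : 'I_D, (fun t => X t i ord0) \in Lfun P 2%:E.

(* [i] and [j] are 1-based, while the vectors [w k] are indexed from 0. *)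
Definition sigma2 (D : nat) (w : 'I_D -> 'cV[R]_D) (X : {RV P >-> 'cV[R]_D})
    (i j : nat) : \bar R :=
  (\sum_(k < D | (i <= k.+1 <= j)%N) 'V_P[fun t => dotcv (w k) (X t)])%E.

End Probability.

Arguments mutually_independent {dT T R} P {I dE E} X.
Arguments identically_distributed {dT T R} P {I dE E} X.
Arguments finite_second_moments {dT T R} P {D} X.
Arguments sigma2 {dT T R} P {D} w X i j.

(* Main.v *)
(* By Parseval, both expectations are sums over k of E[(w_k^T X1 - w_k^T X2)^2],
   and each such term equals 2 Var(w_k^T X) because w_k^T X1 and w_k^T X2 are
   independent with the law of w_k^T X.  Hence the expectation over the first n
   directions is 2 sigma^2(1, n). *)

Require Import Defs.
From mathcomp Require Import all_boot all_order all_algebra.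
From mathcomp Require Import all_classical all_reals all_analysis.
From mathcomp Require Import measurable_realfun ring.
Import Order.TTheory GRing.Theory Num.Theory.
Import numFieldNormedType.Exports.
Local Open Scope classical_set_scope.
Local Open Scope ring_scope.

(** * Orthonormal coordinates in R^D and Borel measurability of projections *)

Section Euclidean.
Context {R : realType} {D : nat}.

Lemma dotcvE (u v : 'cV[R]_D) : dotcv u v = \sum_i u i ord0 * v i ord0.
Proof. by rewrite /dotcv mxE; apply: eq_bigr => i _; rewrite mxE. Qed.

Lemma dotcvBr (u v v' : 'cV[R]_D) : dotcv u (v - v') = dotcv u v - dotcv u v'.
Proof. by rewrite /dotcv mulmxBr !mxE. Qed.

Lemma sqr_norm2 (v : 'cV[R]_D) : norm2 v ^+ 2 = dotcv v v.
Proof.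
rewrite dotcvE sqr_sqrtr; last by apply: sumr_ge0 => i _; exact: sqr_ge0.
by apply: eq_bigr => i _; rewrite expr2.
Qed.

Lemma first_columnsE (w : 'I_D -> 'cV[R]_D) d (d_leD : (d <= D)%N) v k :
  ((first_columns w d_leD)^T *m v) k ord0 = dotcv (w (widen_ord d_leD k)) v.
Proof. by rewrite dotcvE mxE; apply: eq_bigr => i _; rewrite !mxE. Qed.

(** Orthonormality says [W^T *m W = 1]. As [W] is square, this left inverse is also a right inverse,
    so [W *m W^T = 1] and [W^T] preserves dot products. *)
Lemma parseval (w : 'I_D -> 'cV[R]_D) (v : 'cV[R]_D) :
  orthonormal_basis w ->
  norm2 ((first_columns w (leqnn D))^T *m v) = norm2 v.
Proof.
move=> [w_orth w_unit]; set W := first_columns _ _.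
have WTW : W^T *m W = 1%:M.
  apply/matrixP => i j.
  have widenK (k : 'I_D) : widen_ord (leqnn D) k = k by exact/val_inj.
  transitivity (dotcv (w i) (w j)).
    by rewrite dotcvE mxE; apply: eq_bigr => k _; rewrite !mxE !widenK.
  by rewrite mxE; have [->|/w_orth] := eqVneq i j.
have E : dotcv (W^T *m v) (W^T *m v) = dotcv v v.
  by rewrite /dotcv trmx_mul trmxK mulmxA -(mulmxA _ W) (mulmx1C WTW) mulmx1.
have norm2_ge0 n (u : 'cV[R]_n) : 0 <= norm2 u by exact: sqrtr_ge0.
by apply/(@pexpIrn _ 2) => //; rewrite ?nnegrE ?sqr_norm2 // [LHS]sqr_norm2 E.
Qed.

(** Open intervals generate the Borel sets of R, and their preimages under [f] are open, hence among
    the generators on the matrix side. *)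
Lemma continuous_measurable_fun_mx m n (f : 'M[R]_(m, n) -> R) :
  continuous f -> measurable_fun [set: 'M[R]_(m, n)] f.
Proof.
move=> /continuousP cf; apply: (measurability _ (RGenOpens.measurableE R)).
move=> _ [_ [a [b ->] <-]]; rewrite setTI; apply: sub_sigma_algebra.
exact/cf/interval_open.
Qed.

Lemma measurable_dotcv (u : 'cV[R]_D) : measurable_fun setT (dotcv u).
Proof.
apply: continuous_measurable_fun_mx.
rewrite (funext (dotcvE u)).
apply: continuous_big => [|i _]; first exact: add_continuous.
move=> v.
apply: (@continuousM R 'cV[R]_D (cst (u i ord0)) (fun x => x i ord0) v).
  exact: cst_continuous.
exact: coord_continuous.
Qed.

End Euclidean.

(** * Expectations of independent or equidistributed real random variables *)

Section Independence.
Context {d} {T : measurableType d} {R : realType} {P : probability T R}.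
Local Open Scope ereal_scope.

(* Independence makes the joint law a product measure, so Fubini applies. *)
Lemma expectation_indepM (Y Z : {RV P >-> R}) :
  (forall A B, measurable A -> measurable B ->
    P (Y @^-1` A `&` Z @^-1` B) = P (Y @^-1` A) * P (Z @^-1` B)) ->
  (Y : T -> R) \in Lfun P 1 -> (Z : T -> R) \in Lfun P 1 ->
  (Y \* Z)%R \in Lfun P 1 ->
  'E_P[Y \* Z] = 'E_P[Y] * 'E_P[Z].
Proof.
move=> indep Y1 Z1 YZ1.
pose YZ t := (Y t, Z t).
have mYZ : measurable_fun setT YZ by exact: measurable_fun_pair.
pose YZm : {mfun T >-> (R * R)%type} :=
  MeasurableFun.Pack (MeasurableFun.Class (isMeasurableFun.Build _ _ _ _ _ mYZ)).
(* Agreement on rectangles is exactly [indep], and rectangles determine the product measure. *)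
have lawE A : measurable A ->
    (distribution P Y \x distribution P Z) A = distribution P YZm A.
  by apply: product_measure_unique => B C mB mC; exact: indep.
pose f : R * R -> \bar R := fun p => (p.1 * p.2)%:E.
have mf : measurable_fun [set: R * R] f.
  by apply/measurable_EFinP; exact: measurable_funM.
have fYZ_int : P.-integrable setT (f \o YZm) by exact/Lfun1_integrable.
have law_int := integrable_pushforward mYZ mf fYZ_int measurableT.
(* Fubini requires integrability for the product measure; it is carried over from the joint law,
   where it is the integrability of [Y \* Z]. *)
have prod_int : (distribution P Y \x distribution P Z).-integrable setT f.
  apply/integrableP; split => //.
  rewrite (@eq_measure_integral _ _ _ _ (distribution P YZm)); last first.
    by move=> A mA _; exact: lawE.
  by case/integrableP : law_int.
have EZ : 'E_P[Z] = \int[distribution P Z]_y y%:E.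
  by rewrite expectation.unlock integral_distribution//; exact/Lfun1_integrable.
have EY : 'E_P[Y] = \int[distribution P Y]_x x%:E.
  by rewrite expectation.unlock integral_distribution//; exact/Lfun1_integrable.
transitivity (\int[distribution P YZm]_p f p).
  by rewrite expectation.unlock integral_distribution.
rewrite -(@eq_measure_integral _ _ _ _ _
  (distribution P Y \x distribution P Z)); last first.
  by move=> A mA _; exact: lawE.
rewrite -integral12_prod_meas1//.
have law_integrable (U : {RV P >-> R}) : (U : T -> R) \in Lfun P 1 ->
    (distribution P U).-integrable setT EFin.
  by move=> U1; apply: integrable_pushforward => //; exact/Lfun1_integrable.
transitivity (\int[distribution P Y]_x (x%:E * 'E_P[Z])).
  apply: eq_integral => x _; rewrite /fubini_F EZ /f/=.
  under eq_integral => y _ do rewrite EFinM.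
  by rewrite integralZl//; exact: law_integrable.
(* Being finite, the mean of [Z] is a real constant and leaves the outer integral. *)
have EZfin := expectation_fin_num Z1.
under eq_integral => x _ do rewrite -(fineK EZfin).
by rewrite integralZr ?fineK -?EY//; exact: law_integrable.
Qed.

(** Change of variables: each expectation is the integral of [f] against the law, and integrals see
    a measure only through measurable sets. *)
Lemma eq_distribution_expectation (Y Z : {RV P >-> R}) (f : R -> R) :
  (forall A, measurable A -> distribution P Y A = distribution P Z A) ->
  measurable_fun setT f -> f \o Y \in Lfun P 1 -> f \o Z \in Lfun P 1 ->
  'E_P[f \o Y] = 'E_P[f \o Z].
Proof.
move=> lawE mf fY1 fZ1.
have E (U : {RV P >-> R}) : f \o U \in Lfun P 1 ->
    'E_P[f \o U] = \int[distribution P U]_x (f x)%:E.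
  move=> fU1; rewrite expectation.unlock integral_distribution//.
    exact/measurable_EFinP.
  exact/Lfun1_integrable.
by rewrite !E//; apply: eq_measure_integral => A mA _; exact: lawE.
Qed.

Lemma Lfun2_Lfun1 (f : T -> R) : f \in Lfun P 2%:E -> f \in Lfun P 1.
Proof. by apply: Lfun_subset12; exact: fin_num_measure. Qed.

Lemma eq_distribution_variance (Y Z : {RV P >-> R}) :
  (forall A, measurable A -> distribution P Y A = distribution P Z A) ->
  (Y : T -> R) \in Lfun P 2%:E -> (Z : T -> R) \in Lfun P 2%:E ->
  'V_P[Y] = 'V_P[Z].
Proof.
move=> lawE Y2 Z2; rewrite !varianceE//; congr (_ - _ ^+ 2).
  apply: (@eq_distribution_expectation Y Z (fun x => x ^+ 2)%R) => //;
    exact: Lfun2_mul_Lfun1.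
by apply: (@eq_distribution_expectation Y Z id) => //; exact: Lfun2_Lfun1.
Qed.

(** The means of [Y1] and [Y2] agree, so the second moment of the difference is its variance. This
    expands into the two variances minus twice the covariance, which vanishes by independence. *)
Lemma expectation_sqrB_iid (Y Y1 Y2 : {RV P >-> R}) :
  (forall A B, measurable A -> measurable B ->
    P (Y1 @^-1` A `&` Y2 @^-1` B) = P (Y1 @^-1` A) * P (Y2 @^-1` B)) ->
  (forall A, measurable A -> distribution P Y1 A = distribution P Y A) ->
  (forall A, measurable A -> distribution P Y2 A = distribution P Y A) ->
  (Y : T -> R) \in Lfun P 2%:E -> (Y1 : T -> R) \in Lfun P 2%:E ->
  (Y2 : T -> R) \in Lfun P 2%:E ->
  'E_P[fun t => ((Y1 t - Y2 t) ^+ 2)%R] = 2%:E * 'V_P[Y].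
Proof.
move=> indep law1 law2 Y_2 Y1_2 Y2_2.
have [Y1_1 Y2_1] := (Lfun2_Lfun1 _ Y1_2, Lfun2_Lfun1 _ Y2_2).
have Y12_1 := Lfun2_mul_Lfun1 Y1_2 Y2_2.
have meanE : 'E_P[Y1] = 'E_P[Y2].
  apply: (@eq_distribution_expectation Y1 Y2 id) => // A mA.
  by rewrite law1// law2.
have B2 : (Y1 \- Y2)%R \in Lfun P 2%:E by rewrite rpredB// lee1n.
have : 'V_P[(Y1 \- Y2)%R] = 'E_P[fun t => ((Y1 t - Y2 t) ^+ 2)%R].
  rewrite varianceE// expectationB// meanE subee ?expectation_fin_num//.
  by rewrite expe2 mul0e sube0.
move=> <-; rewrite varianceB// covarianceE// expectation_indepM// subee; last first.
  by rewrite fin_numM// expectation_fin_num.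
rewrite mule0 sube0 (eq_distribution_variance _ _ law1)//.
rewrite (eq_distribution_variance _ _ law2)//.
by rewrite mule_natl mule2n.
Qed.

Lemma expectation_sum_fun (I : finType) (f : I -> T -> R) :
  (forall i, f i \in Lfun P 1) ->
  'E_P[fun t => (\sum_i f i t)%R] = \sum_i 'E_P[f i].
Proof.
move=> f1; rewrite -(fct_sumE (index_enum I) predT).
rewrite -(big_map f predT id) expectation_sum ?big_map// => g /mapP[i _ ->].
exact: f1.
Qed.

End Independence.

(** * From random vectors to their projections *)

Section Projections.
Context {d} {T : measurableType d} {R : realType} {P : probability T R} {D : nat}.
Local Open Scope ereal_scope.

Lemma measurable_dotcv_RV (u : 'cV[R]_D) (X : {RV P >-> 'cV[R]_D}) :
  measurable_fun setT (fun t => dotcv u (X t)).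
Proof. by apply: measurableT_comp => //; exact: measurable_dotcv. Qed.

Definition dotcv_RV (u : 'cV[R]_D) (X : {RV P >-> 'cV[R]_D}) : {RV P >-> R} :=
  MeasurableFun.Pack (MeasurableFun.Class
    (isMeasurableFun.Build _ _ _ _ _ (measurable_dotcv_RV u X))).

Lemma Lfun2_dotcv (u : 'cV[R]_D) (X : {RV P >-> 'cV[R]_D}) :
  finite_second_moments P X -> (fun t => dotcv u (X t)) \in Lfun P 2%:E.
Proof.
move=> X2.
rewrite (_ : (fun t => _) = (\sum_i (u i ord0 \o* (fun t => X t i ord0)))%R).
  by apply: rpred_sum => [|? i _]; rewrite ?lee1n// Lfun_scale ?ler1n.
by apply/funext => t; rewrite dotcvE fct_sumE; apply: eq_bigr => i _; rewrite mulrC.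
Qed.

(** Independence and equality of laws pass to the projections because [dotcv u] pulls Borel sets of
    R back to Borel sets of R^D. *)
Lemma expectation_sqr_dotcvB (u : 'cV[R]_D) (X X1 X2 : {RV P >-> 'cV[R]_D}) :
  mutually_independent P (tnth [tuple X; X1; X2]) ->
  identically_distributed P (tnth [tuple X; X1; X2]) ->
  finite_second_moments P X -> finite_second_moments P X1 ->
  finite_second_moments P X2 ->
  'E_P[fun t => ((dotcv u (X1 t) - dotcv u (X2 t)) ^+ 2)%R] =
    2%:E * 'V_P[fun t => dotcv u (X t)].
Proof.
move=> indep id X_2 X1_2 X2_2.
pose i0 := @Ordinal 3 0 isT.
pose i1 := @Ordinal 3 1 isT.
pose i2 := @Ordinal 3 2 isT.
have mdot A : measurable A -> measurable (dotcv u @^-1` A).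
  by move=> mA; rewrite -[X in measurable X]setTI; exact: measurable_dotcv.
apply: (@expectation_sqrB_iid _ _ _ P (dotcv_RV u X) (dotcv_RV u X1) (dotcv_RV u X2)).
- move=> A B mA mB.
  (* Restricting the index set to [i1] and [i2] extracts the independence of the pair [X1], [X2]
     from that of the triple. *)
  have := indep [set i1; i2]%SET
    (fun i => if i == i1 then dotcv u @^-1` A else dotcv u @^-1` B).
  rewrite big_setU1 ?inE//= big_set1/= => <-; last first.
    by move=> i; case: ifP => _; exact: mdot.
  congr (P _); apply/seteqP; split => t /=.
    by move=> [At Bt] i /=; rewrite !inE => /orP[] /eqP ->.
  by move=> AB; split; [apply: (AB i1)|apply: (AB i2)]; rewrite /= !inE eqxx ?orbT.
- by move=> A mA; apply: (id i1 i0 (dotcv u @^-1` A)); exact: mdot.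
- by move=> A mA; apply: (id i2 i0 (dotcv u @^-1` A)); exact: mdot.
- exact: Lfun2_dotcv.
- exact: Lfun2_dotcv.
- exact: Lfun2_dotcv.
Qed.

Lemma expectation_sqr_norm2_first_columns (w : 'I_D -> 'cV[R]_D)
    (X X1 X2 : {RV P >-> 'cV[R]_D}) n (n_leD : (n <= D)%N) :
  mutually_independent P (tnth [tuple X; X1; X2]) ->
  identically_distributed P (tnth [tuple X; X1; X2]) ->
  finite_second_moments P X -> finite_second_moments P X1 ->
  finite_second_moments P X2 ->
  'E_P[fun t => (norm2 ((first_columns w n_leD)^T *m X1 t -
                        (first_columns w n_leD)^T *m X2 t) ^+ 2)%R] =
  2%:E * sigma2 P w X 1 n.
Proof.
move=> indep id X_2 X1_2 X2_2.
have -> : sigma2 P w X 1 n =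
    \sum_(k < n) 'V_P[fun t => dotcv (w (widen_ord n_leD k)) (X t)].
  (* The 1-based condition [1 <= k.+1 <= n] computes to [k < n]. *)
  exact: big_ord_narrow.
rewrite (_ : (fun t => _) = (fun t => \sum_(k < n)
    (dotcv (w (widen_ord n_leD k)) (X1 t) -
     dotcv (w (widen_ord n_leD k)) (X2 t)) ^+ 2)%R); last first.
  apply/funext => t; rewrite sqr_norm2 dotcvE; apply: eq_bigr => k _.
  by rewrite -expr2 -mulmxBr first_columnsE dotcvBr.
rewrite expectation_sum_fun => [|k]; last first.
  have B2 : ((fun t => dotcv (w (widen_ord n_leD k)) (X1 t)) \-
             (fun t => dotcv (w (widen_ord n_leD k)) (X2 t)))%R \in Lfun P 2%:E.
    by apply: rpredB => [|?|?]; rewrite ?lee1n//; exact: Lfun2_dotcv.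
  exact: (Lfun2_mul_Lfun1 B2 B2).
(* In [\bar R] the factor 2 distributes over the sum since the variances are nonnegative. *)
rewrite ge0_sume_distrr => [|k _]; last exact: variance_ge0.
by apply: eq_bigr => k _; exact: expectation_sqr_dotcvB.
Qed.

Lemma sigma2_fin_num (w : 'I_D -> 'cV[R]_D) (X : {RV P >-> 'cV[R]_D}) i j :
  finite_second_moments P X -> sigma2 P w X i j \is a fin_num.
Proof.
by move=> X_2; apply/sum_fin_numP => k _ _; apply: variance_fin_num; exact: Lfun2_dotcv.
Qed.

End Projections.

Theorem lemma3 (R : realType) (dT : measure_display) (T : measurableType dT)
    (P : probability T R) (D : nat) (D_ge1 : (1 <= D)%N)
    (w : 'I_D -> 'cV[R]_D) (w_orthonormal : orthonormal_basis w)
    (X X1 X2 : {RV P >-> 'cV[R]_D})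
    (X_indep : mutually_independent P (tnth [tuple X; X1; X2]))
    (X_id : identically_distributed P (tnth [tuple X; X1; X2]))
    (X_L2 : finite_second_moments P X) (X1_L2 : finite_second_moments P X1)
    (X2_L2 : finite_second_moments P X2)
    (d : nat) (d_ge1 : (1 <= d)%N) (d_leD : (d <= D)%N)
    (sigma2_gt0 : (0 < sigma2 P w X 1 d)%E) :
  ('E_P[fun t => (norm2 (X1 t - X2 t) ^+ 2)%R] =
   sigma2 P w X 1 D / sigma2 P w X 1 d *
   'E_P[fun t => (norm2 ((first_columns w d_leD)^T *m X1 t -
                         (first_columns w d_leD)^T *m X2 t) ^+ 2)%R])%E.
Proof.
have E n (n_leD : (n <= D)%N) :=
  expectation_sqr_norm2_first_columns w _ _ _ _ n_leD X_indep X_id X_L2 X1_L2 X2_L2.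
rewrite E; have := E D (leqnn D).
(* In the case [n = D], Parseval turns the projected distance into the full one. *)
under eq_fun => t do rewrite -mulmxBr parseval//.
move=> ->.
(* Both variance sums are finite, so the goal becomes the real identity [2 * a = a / b * (2 * b)];
   [b > 0] selects the real branch of the extended inverse. *)
move: (sigma2_fin_num w _ 1 D X_L2) (sigma2_fin_num w _ 1 d X_L2) sigma2_gt0.
move: (sigma2 P w X 1 D) (sigma2 P w X 1 d) => [a| |]// [b| |]// _ _.
rewrite lte_fin => b_gt0.
by rewrite inver gt_eqF// -!EFinM; congr EFin; field; rewrite gt_eqF.
Qed.
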